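(* Let $\mu,\nu$ be Borel probability measures on $\mathbb{R}$ with compact support and without atoms, and let $\lambda_C:=\mathcal{W}_\infty(\mu,\nu)$. Let $\bar\gamma\in\mathcal{O}_\infty(\mu,\nu)$ be an $\infty$-cyclically monotone optimal transport plan. Let $\rho^+,\rho^-$ be two positive measures on $\mathbb{R}$ with finite mass such that, with $\rho:=\rho^+-\rho^-$: (a) $\operatorname{spt}\rho^+=M_{\bar\gamma}^+$, $\operatorname{spt}\rho^-=M_{\bar\gamma}^-$ and $\operatorname{spt}\rho=M_{\bar\gamma}$; (b) for any point $\bar x\in M_{\bar\gamma}^+$ which is a left-extreme or a right-extreme point of $M_{\bar\gamma}^+$, $\rho(\{\bar x\})>0$. For $x,y\in\mathbb{R}$ define $$\varphi_r(x):=-\rho((-\infty,x]),\qquad \psi_r(y):=\inf\{-\varphi_r(x) : x\in[y-\lambda_C,y+\lambda_C]\}.$$ Then: (i) $\varphi_r$ has bounded variation (in particular, it has a left limit and a right limit at any point) and is right-continuous; (ii) the support of $(\varphi_r')^-$ is exactly $M_{\bar\gamma}^+$, and the support of $\varphi_r'$ is exactly $M_{\bar\gamma}$; (iii) for any point $\bar x\in M_{\bar\gamma}^+$ which is a left-extreme or a right-extreme point of $M_{\bar\gamma}^+$, $$\lim_{x\to\bar x,\ x<\bar x}\varphi_r(x)>\varphi_r(\bar x);$$ (iv) the couple $(\varphi_r,\psi_r)$ is a pair of Kantorovich potentials, i.e. a maximizer of $$\max\left\{\int\varphi\,d\mu+\int\psi\,d\nu : (\varphi,\psi)\in\mathcal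{U}_{\lambda_C}\right\}.$$
   Context: $\Pi(\mu,\nu)$ is the set of positive Borel measures on $\mathbb{R}\times\mathbb{R}$ with first marginal $\mu$ and second marginal $\nu$ (transport plans). $\mathcal{W}_\infty(\mu,\nu):=\min_{\gamma\in\Pi(\mu,\nu)}\ \gamma\text{-ess sup}\,|x-y|$, and $\mathcal{O}_\infty(\mu,\nu)$ is the set of minimizers (optimal transport plans). $\operatorname{spt}$ denotes the support of a measure (for a signed measure, the support of its total variation). A plan $\gamma\in\Pi(\mu,\nu)$ is $\infty$-cyclically monotone if for all $n\in\mathbb{N}$ and $(x_0,y_0),\dots,(x_n,y_n)\in\operatorname{spt}(\gamma)$, $\max_{0\le i\le n}|x_i-y_i|\le\max_{0\le i\le n}|x_i-y_{i+1}|$, where $y_{n+1}=y_0$. For $\gamma\in\mathcal{O}_\infty(\mu,\nu)$: $M_\gamma^+:=\{x : (x,x+\lambda_C)\in\operatorname{spt}(\gamma)\}$, $M_\gamma^-:=\{x : (x,x-\lambda_C)\in\operatorname{spt}(\gamma)\}$, $M_\gamma:=M_\gamma^+\cup M_\gamma^-$. These are compact sets. For a compact set $A\subset\mathbb{R}$, a point $\bar x\in A$ is a right-extreme (resp. left-extreme) point of $A$ if there exists $\delta>0$ such that the open interval $(\bar x,\bar x+\delta)$ (resp. $(\bar x-\delta,\bar x)$) does not intersect $A$. $\varphi_r'$ is the distributional derivative of $\varphi_r$ (a finite signed measure), and $(\varphi_r')^-$ is its negative part. $\mathcal{U}_\lambda$ is the set of couples $(\varphi,\psi)\in L^1_\mu\times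 L^1_\nu$ such that, for $\mu$-a.e. $x$ and $\nu$-a.e. $y$, $\varphi(x)+\psi(y)\le0$ holds whenever $|y-x|\le\lambda$. The maximum of $\int\varphi\,d\mu+\int\psi\,d\nu$ over $\mathcal{U}_{\lambda_C}$ equals $0$ (known duality result).
   Formalization: In (ii), the claim that the support of (φ_r')^- is exactly M^+ is proved when λ_C > 0 or ρ^+ and ρ^- are mutually singular; for λ_C = 0 with overlapping ρ^+, ρ^- it can fail. *)

(* Defs.v *)
From HB Require Import structures.
From mathcomp Require Import all_boot all_order all_algebra.
From mathcomp Require Import all_classical all_reals all_analysis.
From mathcomp Require Import ess_sup_inf.

Set Implicit Arguments.
Unset Strict Implicit.
Unset Printing Implicit Defensive.

Import Order.TTheory GRing.Theory Num.Theory.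
Import numFieldNormedType.Exports.

Local Open Scope classical_set_scope.
Local Open Scope ring_scope.

(* Stated for a bare set function so that it applies to measures on the Borel
   line and plane, whose carriers are only convertible to [R] and [R * R]. *)
Definition spt (R : realType) (T : topologicalType) (m : set T -> \bar R) :
    set T :=
  [set x | forall U : set T, open U -> U x -> (0 < m U)%E].

Section transport.
Variable R : realType.
Local Notation BR := (measurableTypeR R).

Definition atomless (mu : set BR -> \bar R) : Prop :=
  forall x : R, mu [set x] = 0%E.

Definition transport_plan (mu nu : set BR -> \bar R) :
    set {measure set (BR * BR) -> \bar R} :=
  [set gamma | (forall A, measurable A -> pushforward gamma fst A = mu A) /\
               (forall B, measurable B -> pushforward gamma snd B = nu B)].

Definition sup_cost (gamma : {measure set (BR * BR) -> \bar R}) : \bar R :=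
  ess_sup gamma (fun p : BR * BR => `|(p.1 : R) - (p.2 : R)|%:E).

Definition Winfty (mu nu : set BR -> \bar R) : \bar R :=
  ereal_inf [set sup_cost gamma | gamma in transport_plan mu nu].

Definition optimal_plan (mu nu : set BR -> \bar R) :
    set {measure set (BR * BR) -> \bar R} :=
  [set gamma | transport_plan mu nu gamma /\
     forall gamma', transport_plan mu nu gamma' ->
       (sup_cost gamma <= sup_cost gamma')%E].

(* Finite when mu and nu are probabilities with compact support. *)
Definition lambdaC (mu nu : set BR -> \bar R) : R := fine (Winfty mu nu).

(* [ordS] is the cyclic successor of ['I_n.+1]; the base [0] of the maxima is
   harmless since the terms are nonnegative. *)
Definition infty_cyclically_monotone (gamma : set (BR * BR) -> \bar R) : Prop :=
  forall (n : nat) (x y : 'I_n.+1 -> R),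
    (forall i, @spt R (R * R)%type gamma (x i, y i)) ->
    \big[Num.max/0]_(i < n.+1) `|x i - y i| <=
    \big[Num.max/0]_(i < n.+1) `|x i - y (ordS i)|.

Definition Mplus (l : R) (gamma : set (BR * BR) -> \bar R) : set R :=
  [set x | @spt R (R * R)%type gamma (x, x + l)].

Definition Mminus (l : R) (gamma : set (BR * BR) -> \bar R) : set R :=
  [set x | @spt R (R * R)%type gamma (x, x - l)].

Definition right_extreme (A : set R) (x : R) : Prop :=
  A x /\ exists2 d : R, 0 < d & `]x, x + d[%classic `&` A = set0.

Definition left_extreme (A : set R) (x : R) : Prop :=
  A x /\ exists2 d : R, 0 < d & `]x - d, x[%classic `&` A = set0.

(* mu-a.e. x and nu-a.e. y is read as: outside of a mu-negligible set of x and
   a nu-negligible set of y, chosen independently of one another. *)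
Definition admissible (mu nu : {measure set BR -> \bar R}) (l : R)
    (phi psi : R -> R) : Prop :=
  [/\ mu.-integrable setT (EFin \o phi), nu.-integrable setT (EFin \o psi) &
      exists N1 N2 : set R, [/\ mu.-negligible N1, nu.-negligible N2 &
        forall x y : R, ~ N1 x -> ~ N2 y -> `|y - x| <= l ->
          phi x + psi y <= 0]].

Definition kantorovich_pair (mu nu : {measure set BR -> \bar R}) (l : R)
    (phi psi : R -> R) : Prop :=
  admissible mu nu l phi psi /\
  forall phi' psi' : R -> R, admissible mu nu l phi' psi' ->
    \int[mu]_x phi' x + \int[nu]_y psi' y <=
    \int[mu]_x phi x + \int[nu]_y psi y.

End transport.

Section signed_measures.
Variable R : realType.
Local Notation BR := (measurableTypeR R).

Definition hahn_sets (rho : {charge set BR -> \bar R}) :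
    {PN : set BR * set BR | hahn_decomposition rho PN.1 PN.2} :=
  cid (let: ex_intro P (ex_intro N h) := Hahn_decomposition rho in
       ex_intro (fun PN => hahn_decomposition rho PN.1 PN.2) (P, N) h).

Definition charge_pos (rho : {charge set BR -> \bar R}) :
    {measure set BR -> \bar R} :=
  jordan_pos (svalP (hahn_sets rho)).

Definition charge_neg (rho : {charge set BR -> \bar R}) :
    {measure set BR -> \bar R} :=
  jordan_neg (svalP (hahn_sets rho)).

Definition charge_tv (rho : {charge set BR -> \bar R}) :
    {measure set BR -> \bar R} :=
  charge_variation (svalP (hahn_sets rho)).

Definition charge_diff (m1 m2 : {finite_measure set BR -> \bar R}) :
    {charge set BR -> \bar R} :=
  cadd (charge_of_finite_measure m1) (copp (charge_of_finite_measure m2)).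

Definition mutually_singular (m1 m2 : set BR -> \bar R) : Prop :=
  exists A : set BR, [/\ measurable A, m1 A = 0%E & m2 (~` A) = 0%E].

Definition test_function (f : R -> R) : Prop :=
  (forall (n : nat) (x : R), derivable (derive1n n f) x 1) /\
  compact (closure [set x | f x != 0]).

Definition distributional_derivative (phi : R -> R)
    (D : {charge set BR -> \bar R}) : Prop :=
  locally_integrable setT phi /\
  forall f : R -> R, test_function f ->
    \int[charge_pos D]_x f x - \int[charge_neg D]_x f x =
    - \int[lebesgue_measure]_x (phi x * derive1 f x).

Definition bounded_variation_line (phi : R -> R) : Prop :=
  (ereal_sup [set total_variation ab.1 ab.2 phi |
              ab in [set ab : R * R | (ab.1 <= ab.2)%R]] < +oo)%E.

Definition phi_r (rho : {charge set BR -> \bar R}) (x : R) : R :=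
  - fine (rho `]-oo, x]%classic).

Definition psi_r (l : R) (rho : {charge set BR -> \bar R}) (y : R) : R :=
  inf [set - phi_r rho x | x in `[y - l, y + l]%classic].

End signed_measures.

(* Main.v *)
Require Import Defs.
From HB Require Import structures.
From mathcomp Require Import all_boot all_order all_algebra.
From mathcomp Require Import all_classical all_reals all_analysis.
From mathcomp Require Import measurable_realfun ess_sup_inf.
From mathcomp Require Import lra.

Set Implicit Arguments.
Unset Strict Implicit.
Unset Printing Implicit Defensive.

Import Order.TTheory GRing.Theory Num.Theory.
Import numFieldNormedType.Exports.

Local Open Scope classical_set_scope.
Local Open Scope ring_scope.

(* With G x = rho (]-oo, x]), phi_r = - G and psi_r y = inf of G over
   [y - l, y + l].  The derivative of phi_r is - rho by Fubini and the fundamental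
   theorem of calculus.  Weak duality along gamma bounds every admissible value by
   0, so optimality reduces to psi_r y = G x for gamma-almost every (x, y), i.e. to
   x minimizing G on [y - l, y + l].  For (x, y) in spt gamma, cyclic monotonicity
   with two points shows that M+ misses ]y - l, x[ and M- misses ]x, y + l[, so G
   does not increase before x and does not decrease after x, up to a possible atom
   of rho+ at x or of rho- at y + l.  Atoms are countable and mu, nu are atomless,
   so these exceptions are negligible.  The same gap at a point x of M+ and M-
   makes x left-extreme in M+, so that hypothesis (b) prevents rho- from cancelling
   rho+ there; this gives the support of the negative part of the derivative. *)

(** * Supports: their complements are negligible, on the line and on the plane *)

Section support.
Variable R : realType.
Local Notation BR := (measurableTypeR R).
Local Notation BR2 := (measurableTypeR R * measurableTypeR R)%type.

(** Each point of a null member of [O] lies in a null basic set [B i], and there are only countably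
    many of these. The family [O] is abstract so that the same argument serves the open sets of the
    line and of the plane. *)
Lemma countable_base_negligible d (T : measurableType d)
    (m : {measure set T -> \bar R}) (I : countType) (O : set (set T))
    (B : I -> set T) :
  (forall i, measurable (B i)) ->
  (forall U, O U -> measurable U) ->
  (forall U x, O U -> U x -> exists2 i, B i x & B i `<=` U) ->
  m.-negligible [set x | exists U, [/\ O U, U x & m U = 0%E]].
Proof.
move=> mB mO base.
pose F (n : nat) : set T := if unpickle n is Some i then
  (if m (B i) == 0%E then B i else set0) else set0.
apply: (@negligibleS _ _ _ _ (\bigcup_n F n)); last first.
  apply: negligible_bigcup => n; rewrite /F.
  case: (unpickle n) => [i|]; last exact: negligible_set0.
  by case: ifPn => [/eqP mi|_]; [exact/negligibleP|exact: negligible_set0].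
move=> x [U [OU Ux mU]]; have [i Bx BU] := base _ _ OU Ux.
exists (pickle i) => //; rewrite /F pickleK ifT//.
rewrite eq_le measure_ge0 andbT -mU le_measure// inE; [exact: mB|exact: mO].
Qed.

Let ratitv (p : rat * rat) : set R := `]ratr p.1, ratr p.2[%classic.

Lemma nbhs_ratitv (x : R) (U : set R) : nbhs x U ->
  exists2 p, ratitv p x & ratitv p `<=` U.
Proof.
move=> /nbhs_ballP[e /= e0 eU].
have /rat_in_itvoo[p] : x - e < x by rewrite ltrBlDr ltrDl.
rewrite in_itv/= => /andP[p1 p2].
have /rat_in_itvoo[q] : x < x + e by rewrite ltrDl.
rewrite in_itv/= => /andP[q1 q2].
exists (p, q); first by rewrite /ratitv/= in_itv/= p2.
move=> y; rewrite /ratitv/= in_itv/= => /andP[py yq]; apply: eU.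
by rewrite -ball_normE/= ltr_distlC (lt_trans p1 py) (lt_trans yq q2).
Qed.

Lemma nbhs_ratrect (z : R * R) (U : set (R * R)) : nbhs z U ->
  exists2 pq : (rat * rat) * (rat * rat), (ratitv pq.1 `*` ratitv pq.2) z &
    ratitv pq.1 `*` ratitv pq.2 `<=` U.
Proof.
move=> [[A B] /= [/nbhs_ratitv[p pz pA] /nbhs_ratitv[q qz qB]] ABU].
by exists (p, q) => // w [/= w1 w2]; apply: ABU; split; [exact: pA|exact: qB].
Qed.

Lemma measurable_ratrect (pq : (rat * rat) * (rat * rat)) :
  measurable (ratitv pq.1 `*` ratitv pq.2 : set BR2).
Proof. by apply: measurableX; exact: measurable_itv. Qed.

(** The sigma-algebra of the plane is the product one, so [U] is written as the countable union of
    the rational rectangles that it contains. *)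
Lemma open_prod_measurable (U : set (R * R)) : open U ->
  measurable (U : set BR2).
Proof.
move=> oU.
pose D := [set pq | ratitv pq.1 `*` ratitv pq.2 `<=` U].
rewrite (_ : U = \bigcup_pq
    (if pq \in D then ratitv pq.1 `*` ratitv pq.2 else set0)).
  apply: countable_bigcupT_measurable => // pq.
  by case: ifP => _; [exact: measurable_ratrect|exact: measurable0].
rewrite -bigcup_mkcond; apply/seteqP; split => [x Ux|x [pq pqU]]; last exact: pqU.
have [pq pqx pqU] := nbhs_ratrect (open_nbhs_nbhs (conj oU Ux)).
by exists pq.
Qed.

Lemma spt_conull (m : {measure set BR -> \bar R}) :
  m.-negligible (~` spt (T := R) m).
Proof.
have := @countable_base_negligible _ BR m _ (@open R) ratitv.
move=> /(_ (fun _ => measurable_itv _) (@open_measurable R)) mneg.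
apply: negligibleS (mneg _) => [x /existsNP[U /not_implyP[oU] /not_implyP[Ux]]|].
  move=> /negP; rewrite -leNgt => mU; exists U; split => //.
  by apply/eqP; rewrite -measure_le0.
by move=> U x oU Ux; apply: nbhs_ratitv; exact: open_nbhs_nbhs.
Qed.

Lemma spt_prod_conull (m : {measure set BR2 -> \bar R}) :
  m.-negligible (~` spt (T := (R * R)%type) m).
Proof.
have := countable_base_negligible m
  measurable_ratrect open_prod_measurable.
move=> mneg.
apply: negligibleS (mneg _) => [x /existsNP[U /not_implyP[oU] /not_implyP[Ux]]|].
  move=> /negP; rewrite -leNgt => mU; exists U; split => //.
  by apply/eqP; rewrite -measure_le0.
by move=> U x oU Ux; apply: nbhs_ratrect; exact: open_nbhs_nbhs.
Qed.

End support.

(** * Cumulative functions: one-sided limits and bounded variation *)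

Section cumulative_function.
Variable R : realType.
Local Notation BR := (measurableTypeR R).
Local Notation cumul m := (fun x : R => fine (m `]-oo, x]%classic)).

Lemma cumul_nondecreasing (P : {finite_measure set BR -> \bar R}) :
  nondecreasing_fun (cumul P).
Proof.
move=> x y xy; apply: fine_le; rewrite ?fin_num_measure//.
by rewrite le_measure ?inE//; apply: subset_itvl; rewrite bnd_simp.
Qed.

Lemma cumul_ge0_le (P : {finite_measure set BR -> \bar R}) (x : R) :
  0 <= cumul P x <= fine (P setT).
Proof.
rewrite fine_ge0//=.
by apply: fine_le; rewrite ?fin_num_measure// le_measure ?inE.
Qed.

Lemma measurable_cumul (P : {finite_measure set BR -> \bar R}) :
  measurable_fun setT (cumul P : BR -> R).
Proof. by apply: nondecreasing_measurable => //; exact: cumul_nondecreasing. Qed.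

Lemma bounded_cumul (P : {finite_measure set BR -> \bar R}) (A : set BR) :
  [bounded (cumul P : BR -> R) x | x in A].
Proof.
exists (fine (P setT)); split; first exact: num_real.
move=> M PM x _ /=; have /andP[P0 P1] := cumul_ge0_le P x.
by rewrite ger0_norm// (le_trans P1)// ltW.
Qed.

(** Continuity from above of [P] gives the limit along [x + 1/(n+1)]; monotonicity squeezes all
    values in between, so a single index [n] controls a right neighbourhood of [x]. *)
Lemma cumul_cvg_right (P : {finite_measure set BR -> \bar R}) (x : R) :
  cumul P z @[z --> x^'+] --> cumul P x.
Proof.
have Pcvg : P `]-oo, x + n.+1%:R^-1]%classic @[n --> \oo] --> P `]-oo, x]%classic.
  rewrite (itvNycEbigcap false x); apply: nonincreasing_cvg_mu.
  - by rewrite -ge0_fin_numE// fin_num_measure.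
  - by move=> n; exact: measurable_itv.
  - by apply: bigcap_measurable => // n _; exact: measurable_itv.
  - move=> n m nm; apply/subsetPset; apply: subset_itvl.
    by rewrite bnd_simp lerD2l lef_pV2 ?posrE// ler_nat.
have {}Pcvg : cumul P (x + n.+1%:R^-1) @[n --> \oo] --> cumul P x.
  by apply: fine_cvg; rewrite fineK// fin_num_measure.
apply/cvgrPdist_le => e e0.
move/cvgrPdist_le : Pcvg => /(_ _ e0)[n _ /(_ _ (leqnn n)) nP].
near=> z; apply: le_trans nP.
have xz : x <= z by near: z; exact: nbhs_right_ge.
have zx : z <= x + n.+1%:R^-1.
  by near: z; apply: nbhs_right_le; rewrite ltrDl invr_gt0.
have h1 := @cumul_nondecreasing P x z xz.
have h2 := @cumul_nondecreasing P z _ zx.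
rewrite !(distrC (fine (P `]-oo, x]%classic))) !ger0_norm ?subr_ge0 ?lerD2r//.
exact: le_trans h1 h2.
Unshelve. all: by end_near. Qed.

Lemma cumul_cvg_left (P : {finite_measure set BR -> \bar R}) (x : R) :
  cumul P z @[z --> x^'-] --> fine (P `]-oo, x[%classic).
Proof.
have xE : `]-oo, x[%classic = \bigcup_n `]-oo, x - n.+1%:R^-1]%classic.
  apply/seteqP; split=> y /=; last first.
    move=> [n _] /=; rewrite !in_itv/= => /le_lt_trans; apply.
    by rewrite ltrBlDr ltrDl invr_gt0.
  rewrite in_itv/= -subr_gt0 => yx.
  (* This [n] satisfies [1/(n+1) <= x - y]. *)
  exists (Num.truncn (x - y)^-1) => //=; rewrite in_itv/= lerBrDr -lerBrDl.
  by rewrite invf_ple ?posrE// ltW// truncnS_gt.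
have Pcvg : P `]-oo, x - n.+1%:R^-1]%classic @[n --> \oo] --> P `]-oo, x[%classic.
  rewrite xE; apply: nondecreasing_cvg_mu.
  - by move=> n; exact: measurable_itv.
  - by apply: bigcup_measurable => // n _; exact: measurable_itv.
  - move=> n m nm; apply/subsetPset; apply: subset_itvl.
    by rewrite bnd_simp lerD2l lerN2 lef_pV2 ?posrE// ler_nat.
have {}Pcvg : cumul P (x - n.+1%:R^-1) @[n --> \oo] --> fine (P `]-oo, x[%classic).
  by apply: fine_cvg; rewrite fineK// fin_num_measure.
apply/cvgrPdist_le => e e0.
move/cvgrPdist_le : Pcvg => /(_ _ e0)[n _ /(_ _ (leqnn n)) nP].
near=> z; apply: le_trans nP.
have zx : z < x by near: z; exact: nbhs_left_lt.
have xz : x - n.+1%:R^-1 <= z.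
  by near: z; apply: nbhs_left_ge; rewrite ltrBlDr ltrDl invr_gt0.
have h1 := @cumul_nondecreasing P _ z xz.
have h2 : cumul P z <= fine (P `]-oo, x[%classic).
  apply: fine_le; rewrite ?fin_num_measure//.
  by rewrite le_measure ?inE//; apply: subset_itvl; rewrite bnd_simp.
rewrite !ger0_norm ?subr_ge0//; first by rewrite lerD2l lerN2.
exact: le_trans h1 h2.
Unshelve. all: by end_near. Qed.

Lemma fine_jordan (D : {charge set BR -> \bar R}) (A : set BR) :
  measurable A ->
  fine (D A) = fine (charge_pos D A) - fine (charge_neg D A).
Proof.
move=> mA; rewrite (jordan_decomp (svalP (hahn_sets D)) mA) /cadd/= cscaleN1.
by rewrite fineB// fin_num_measure.
Qed.

Lemma charge_cumulE (D : {charge set BR -> \bar R}) :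
  cumul D = cumul (charge_pos D) \- cumul (charge_neg D).
Proof. by apply/funext => x; exact: fine_jordan. Qed.

Lemma charge_cumul_cvg_right (D : {charge set BR -> \bar R}) (x : R) :
  cumul D z @[z --> x^'+] --> cumul D x.
Proof.
by rewrite charge_cumulE; apply: cvgB; exact: cumul_cvg_right.
Qed.

Lemma charge_cumul_cvg_left (D : {charge set BR -> \bar R}) (x : R) :
  cumul D z @[z --> x^'-] --> fine (D `]-oo, x[%classic).
Proof.
by rewrite charge_cumulE fine_jordan//; apply: cvgB; exact: cumul_cvg_left.
Qed.

(** A difference of two nondecreasing functions: on every segment each one varies by at most the
    total mass of its Jordan part, a bound independent of the segment. *)
Lemma charge_cumul_bounded_variation (D : {charge set BR -> \bar R}) :
  bounded_variation_line (cumul D).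
Proof.
pose P := jordan_pos (svalP (hahn_sets D)).
pose N := jordan_neg (svalP (hahn_sets D)).
have TVle (Q : {finite_measure set BR -> \bar R}) a b : a <= b ->
    (total_variation a b (cumul Q) <= Q setT)%E.
  move=> ab; rewrite nondecreasing_total_variation//; last first.
    by move=> x y _ _; exact: cumul_nondecreasing.
  rewrite -(@fineK _ (Q setT)) ?fin_num_measure// lee_fin lerBlDr.
  apply: ler_wpDr; first exact: fine_ge0.
  by apply: fine_le; rewrite ?fin_num_measure// le_measure ?inE.
apply: (@le_lt_trans _ _ (P setT + N setT)%E); last first.
  by rewrite -ge0_fin_numE ?adde_ge0// fin_numD !fin_num_measure.
apply: ge_ereal_sup => _ [[a b] /= ab <-].
rewrite charge_cumulE; apply: le_trans (total_variation_le _ _ ab) _.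
apply: leeD; first exact: (TVle P).
by rewrite total_variationN; exact: (TVle N).
Qed.

(** Makes the results on cumulative functions of charges available for [phi_r]. *)
Lemma phi_rE (rho : {charge set BR -> \bar R}) : phi_r rho = cumul (copp rho).
Proof. by apply/funext => x; rewrite /phi_r /copp/= fineN. Qed.

End cumulative_function.

(** * Jordan parts of a charge and of a difference of measures *)

Section jordan.
Variable R : realType.
Local Notation BR := (measurableTypeR R).
Implicit Types (rho : {charge set BR -> \bar R}) (A P N : set BR).

(** [charge_pos] is built on a decomposition picked by choice; by uniqueness any other one computes
    the same values. *)
Lemma charge_posE rho P N A : hahn_decomposition rho P N -> measurable A ->
  charge_pos rho A = rho (A `&` P).
Proof.
move=> hPN mA.
have [<- _] := Hahn_decomposition_uniq (svalP (hahn_sets rho)) hPN mA.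
have := jordan_posE (svalP (hahn_sets rho)) A.
by rewrite cjordan_posE /crestr0 mem_set.
Qed.

Lemma charge_negE rho P N A : hahn_decomposition rho P N -> measurable A ->
  charge_neg rho A = (- rho (A `&` N))%E.
Proof.
move=> hPN mA.
have [_ <-] := Hahn_decomposition_uniq (svalP (hahn_sets rho)) hPN mA.
have := jordan_negE (svalP (hahn_sets rho)) A.
by rewrite cjordan_negE /crestr0 mem_set.
Qed.

Lemma hahn_decomposition_copp rho P N :
  hahn_decomposition rho P N -> hahn_decomposition (copp rho) N P.
Proof.
move=> [[mP posP] [mN negN] PN PN0]; split.
- by split=> // A mA AN; rewrite /copp/= oppe_ge0 negN.
- by split=> // A mA AP; rewrite /copp/= oppe_le0 posP.
- by rewrite setUC.
- by rewrite setIC.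
Qed.

Lemma charge_pos_copp rho A : measurable A ->
  charge_pos (copp rho) A = charge_neg rho A.
Proof.
move=> mA; have h := svalP (hahn_sets rho).
by rewrite (charge_posE (hahn_decomposition_copp h) mA) (charge_negE h mA).
Qed.

Lemma charge_neg_copp rho A : measurable A ->
  charge_neg (copp rho) A = charge_pos rho A.
Proof.
move=> mA; have h := svalP (hahn_sets rho).
rewrite (charge_negE (hahn_decomposition_copp h) mA) (charge_posE h mA).
by rewrite /copp/= oppeK.
Qed.

Lemma charge_tv_copp rho A : measurable A ->
  charge_tv (copp rho) A = charge_tv rho A.
Proof.
move=> mA.
transitivity (charge_pos (copp rho) A + charge_neg (copp rho) A)%E; first by [].
by rewrite charge_pos_copp// charge_neg_copp// addeC.
Qed.

Lemma charge_le_pos rho A : measurable A -> (rho A <= charge_pos rho A)%E.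
Proof.
move=> mA; rewrite (jordan_decomp (svalP (hahn_sets rho)) mA) /cadd/= cscaleN1.
by rewrite -[leRHS]adde0 leeD2l// oppe_le0.
Qed.

Variables p m : {finite_measure set BR -> \bar R}.
Local Notation rho := (charge_diff p m).

Lemma charge_diffE A : rho A = (p A - m A)%E.
Proof. by []. Qed.

Lemma charge_pos_diff_le A : measurable A -> (charge_pos rho A <= p A)%E.
Proof.
move=> mA; have [P [N h]] := Hahn_decomposition rho.
rewrite (charge_posE h mA) charge_diffE; case: h => [[mP _] _ _ _].
apply: (@le_trans _ _ (p (A `&` P))).
  by rewrite -[leRHS]adde0 leeD2l// oppe_le0.
by rewrite le_measure ?inE//; exact: measurableI.
Qed.

(** Inside [A] the charge coincides with [p], so [p] must vanish on the part of [A] in the negative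
    Hahn set; the mass of [A] all sits in the positive one. *)
Lemma charge_pos_diff_disjoint A : measurable A -> m A = 0%E ->
  charge_pos rho A = p A.
Proof.
move=> mA mA0.
have m0 B : measurable B -> B `<=` A -> m B = 0%E.
  move=> mB BA; apply/eqP; rewrite eq_le measure_ge0 andbT -mA0.
  by rewrite le_measure ?inE.
have [P [N h]] := Hahn_decomposition rho.
rewrite (charge_posE h mA) charge_diffE; case: h => [[mP _] [mN negN] PN PN0].
have mAP := measurableI _ _ mA mP; have mAN := measurableI _ _ mA mN.
rewrite (m0 (A `&` P))// sube0.
have pAN : p (A `&` N) = 0%E.
  have := negN _ mAN (@subIsetr _ _ _).
  rewrite charge_diffE (m0 (A `&` N))// sube0 => pAN.
  by apply/eqP; rewrite eq_le pAN measure_ge0.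
rewrite -[in RHS](setIT A) -PN setIUr measureU//.
  by rewrite -[LHS]adde0; congr (_ + _)%E.
by rewrite setIACA PN0 setI0.
Qed.

(** The set [S] separating [p] from [m] yields a Hahn decomposition, with positive set the
    complement of [S] and negative set [S]. *)
Lemma charge_pos_diff_singular A : mutually_singular p m -> measurable A ->
  charge_pos rho A = p A.
Proof.
move=> [S [mS pS mSC]] mA.
have mCS := measurableC mS.
have p0 B : measurable B -> B `<=` S -> p B = 0%E.
  move=> mB BS; apply/eqP; rewrite eq_le measure_ge0 andbT -pS.
  by rewrite le_measure ?inE.
have m0 B : measurable B -> B `<=` ~` S -> m B = 0%E.
  move=> mB BS; apply/eqP; rewrite eq_le measure_ge0 andbT -mSC.
  by rewrite le_measure ?inE.
have h : hahn_decomposition rho (~` S) S.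
  split; last 2 first.
  - by rewrite setUC setUv.
  - by rewrite setICl.
  - by split=> // B mB BS; rewrite charge_diffE m0// sube0.
  - by split=> // B mB BS; rewrite charge_diffE p0// sub0e oppe_le0.
rewrite (charge_posE h mA) charge_diffE.
have mAS := measurableI _ _ mA mS; have mACS := measurableI _ _ mA mCS.
rewrite (m0 (A `&` ~` S))// sube0.
rewrite -[in RHS](setIT A) -(setUv S) setIUr measureU//.
  by rewrite -[LHS]add0e; congr (_ + _)%E; apply/esym/p0.
by rewrite setIACA setICr setI0.
Qed.

End jordan.

(** * Integration by parts against test functions, for a positive measure *)

Section distributional_derivative.
Variable R : realType.
Local Notation BR := (measurableTypeR R).
Local Notation cumul m := (fun x : R => fine (m `]-oo, x]%classic)).
Local Notation leb := (@lebesgue_measure R).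

Lemma test_function_vanishing (f : R -> R) : test_function f ->
  exists2 a, 0 < a & forall x, a <= `|x| -> f x = 0 /\ derive1 f x = 0.
Proof.
move=> [_ /compact_bounded[M [_ bM]]].
have fM x : `|M| + 1 < `|x| -> f x = 0.
  move=> xM; apply: contrapT => /eqP fx.
  have /bM : M < `|M| + 1 by rewrite ltr_pwDr// ler_norm.
  have cx : closure [set x | f x != 0] x by apply: subset_closure.
  by move=> /(_ x cx); rewrite /= leNgt xM.
(* The radius exceeds [|M| + 1], so [f] vanishes on a whole neighbourhood of [x] and its derivative
   at [x] is zero too. *)
exists (`|M| + 2) => [|x xM]; first by rewrite ltr_wpDl.
have {}xM : `|M| + 1 < `|x| by apply: lt_le_trans xM; rewrite ltrD2l ltr1n.
split; first exact: fM.
rewrite derive1E (@near_eq_derive _ _ _ _ (cst 0)) ?derive_cst//.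
near=> z; apply: fM; near: z.
by have /cvgr_gt := @norm_continuous _ _ x; exact.
Unshelve. all: by end_near. Qed.

Variable f : R -> R.
Hypothesis tf : test_function f.

Let df x : derivable f x 1.
Proof. by case: tf => /(_ 0%N x). Qed.

Let cf' : continuous (derive1 f).
Proof.
move=> x; apply: differentiable_continuous; apply/derivable1_diffP.
by case: tf => /(_ 1%N x).
Qed.

Let mf' : measurable_fun setT (derive1 f : BR -> R).
Proof. exact: continuous_measurable_fun. Qed.

Lemma integrable_test_derive : leb.-integrable setT (EFin \o derive1 f).
Proof.
have [a a0 fa] := test_function_vanishing tf.
rewrite (_ : EFin \o derive1 f = (EFin \o derive1 f) \_ `[- a, a]); last first.
  apply/funext => x; rewrite patchE; case: ifPn => // /negP xa.
  rewrite /= (fa x _).2// leNgt; apply/negP => /ltW; rewrite ler_norml => xa'.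
  by apply: xa; rewrite inE/= in_itv.
apply/(integrable_mkcond _ _).1 => //; apply: continuous_compact_integrable.
  exact: segment_compact.
exact: continuous_subspaceT.
Qed.

Lemma bounded_test_function : [bounded f x | x in setT].
Proof.
have [a a0 fa] := test_function_vanishing tf.
have cf : {within `[- a, a], continuous f}.
  by apply: derivable_within_continuous => x _; exact: df.
have /compact_bounded[M [Mreal bM]] :=
  continuous_compact cf (@segment_compact R (- a) a).
exists `|M|; split; first exact: num_real.
move=> B MB x _ /=; have [xa|/ltW xa] := leP `|x| a.
  apply: (bM B); first by rewrite (le_lt_trans (ler_norm M)).
  by exists x => //=; rewrite in_itv/= -ler_norml.
by rewrite (fa x xa).1 normr0 (le_trans (normr_ge0 M))// ltW.
Qed.

Lemma integrable_test_function (P : {finite_measure set BR -> \bar R}) :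
  P.-integrable setT (EFin \o f).
Proof.
apply: measurable_bounded_integrable => //; last exact: bounded_test_function.
  by rewrite -ge0_fin_numE// fin_num_measure.
apply: continuous_measurable_fun => x; apply: differentiable_continuous.
exact/derivable1_diffP.
Qed.

(** Past the radius [a] both [f] and its derivative vanish. For [t < a] the fundamental theorem on
    [[t, a]] gives [f a - f t] with [f a = 0]; for [a <= t] both sides are zero. *)
Lemma integral_test_derive_ray (t : R) :
  (\int[leb]_x (derive1 f x * \1_(`[t, +oo[) x)%:E = (- f t)%:E)%E.
Proof.
have [a a0 fa] := test_function_vanishing tf.
have [ta|at_] := ltP t a; last first.
  rewrite (fa t _).1 ?ler_normr ?at_// oppr0 integral0_eq// => x _.
  rewrite indicE; case: (boolP (x \in _)); last by rewrite mulr0.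
  rewrite inE/= in_itv/= andbT => tx.
  by rewrite (fa x _).2 ?mul0r// ler_normr (le_trans at_ tx).
have -> : (fun x => (derive1 f x * \1_(`[t, +oo[) x)%:E) =
    (EFin \o derive1 f) \_ `[t, a].
  apply/funext => x; rewrite patchE indicE !mem_setE !in_itv/= andbT.
  have [tx|] := leP t x; last by rewrite mulr0.
  have [xa|/ltW ax] := leP x a; first by rewrite mulr1.
  by rewrite mulr1 (fa x _).2// ler_normr ax.
rewrite -integral_mkcond (@continuous_FTC2 _ _ f)//.
- by rewrite (fa a _).1 ?ler_normr ?lexx// sub0e -EFinN.
- exact: continuous_subspaceT.
- split => //.
  + apply: cvg_at_right_filter; apply: differentiable_continuous.
    exact/derivable1_diffP.
  + apply: cvg_at_left_filter; apply: differentiable_continuous.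
    exact/derivable1_diffP.
Qed.

Variable P : {finite_measure set BR -> \bar R}.

Lemma integrable_cumul_test_derive :
  leb.-integrable setT (fun x => (cumul P x * derive1 f x)%:E).
Proof.
rewrite (_ : (fun _ => _) = (EFin \o cumul P) \* (EFin \o derive1 f))%E; last first.
  by apply/funext => x /=; rewrite EFinM.
apply: integrableMr => //; last exact: integrable_test_derive.
  exact: measurable_cumul.
exact: bounded_cumul.
Qed.

(** Fubini for the derivative of [f] on the half-plane [t <= x]: integrating first in [t] produces
    the mass of []-oo, x]], integrating first in [x] produces [- f t]. *)
Lemma integral_cumul_test_derive :
  (\int[leb]_x (cumul P x * derive1 f x)%:E = \int[P]_t (- f t)%:E)%E.
Proof.
pose g (z : BR * BR) : \bar R := (derive1 f z.1 * \1_[set w | w.2 <= w.1] z)%:E.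
have mle : measurable ([set w | w.2 <= w.1] : set (BR * BR)).
  rewrite -[X in measurable X]setCK; apply: measurableC.
  rewrite (_ : ~` _ = [set w : R * R | w.1 < w.2]); last first.
    by apply/seteqP; split => w /=; rewrite ltNge => /negP.
  rewrite (_ : [set _ | _] = (fun w : R * R => w.2 - w.1) @^-1` [set r | 0 < r]).
    apply: open_prod_measurable; apply: open_comp => [w _|]; last exact: open_gt.
    by apply: cvgB; [exact: cvg_snd|exact: cvg_fst].
  by apply/seteqP; split => w /=; rewrite subr_gt0.
have mg : measurable_fun setT g.
  apply/measurable_EFinP; apply: measurable_funM; last exact: measurable_indic.
  exact: measurableT_comp mf' measurable_fst.
have g1 x t : g (x, t) = (derive1 f x * \1_(`]-oo, x]%classic : set BR) t)%:E.
  by rewrite /g !indicE/= !mem_setE in_itv.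
have g2 x t : g (x, t) = (derive1 f x * \1_(`[t, +oo[) x)%:E.
  by rewrite /g !indicE/= !mem_setE in_itv/= andbT.
have intind x : P.-integrable setT (EFin \o \1_(`]-oo, x]%classic : set BR)).
  exact: integrable_indic.
have intg x : (\int[P]_t g (x, t) = (cumul P x * derive1 f x)%:E)%E.
  under eq_integral do rewrite g1 EFinM.
  rewrite integralZl//; last exact: intind.
  by rewrite integral_indic// setIT EFinM muleC fineK// fin_num_measure.
rewrite -(eq_integral _ _ (fun x _ => intg x)).
rewrite (@Fubini _ _ BR BR R leb P g).
- by apply: eq_integral => t _; under eq_integral do rewrite g2;
    rewrite integral_test_derive_ray.
(* Tonelli: the inner integral of [|g|] in [t] is the absolute value of [cumul P x] times the
   derivative of [f], already known to be integrable. *)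
apply/integrable12ltyP => //.
have intg' x : (\int[P]_t `|g (x, t)| = `|(cumul P x * derive1 f x)%:E|)%E.
  have gE t : (`|g (x, t)| =
      `|derive1 f x|%:E * (\1_(`]-oo, x]%classic : set BR) t)%:E)%E.
    by rewrite g1 EFinM abseM; congr (_ * _)%E; rewrite gee0_abs// lee_fin.
  rewrite (eq_integral _ _ (fun t _ => gE t)).
  rewrite integralZl//; last exact: intind.
  rewrite integral_indic// setIT EFinM muleC abseM fineK ?fin_num_measure//.
  by rewrite gee0_abs.
rewrite (eq_integral _ _ (fun x _ => intg' x)).
by have /integrableP[] := integrable_cumul_test_derive.
Qed.

End distributional_derivative.

(** * A charge as the derivative of its cumulative function *)

Section charge_distributional_derivative.
Variable R : realType.
Local Notation BR := (measurableTypeR R).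
Local Notation cumul m := (fun x : R => fine (m `]-oo, x]%classic)).
Local Notation leb := (@lebesgue_measure R).

Lemma locally_integrable_cumul (P : {finite_measure set BR -> \bar R}) :
  locally_integrable setT (cumul P).
Proof.
split; [exact: measurable_cumul|exact: openT|move=> K _ cK].
have mK : measurable (K : set BR) by exact: compact_measurable.
have : leb.-integrable K (EFin \o (cumul P : BR -> R)).
  apply: measurable_bounded_integrable => //.
  - exact: compact_finite_measure.
  - by apply: measurable_funTS; exact: measurable_cumul.
  - exact: bounded_cumul.
by move=> /integrableP[].
Qed.

(** By linearity, from the formula for positive measures applied to both Jordan parts. *)
Lemma cumul_distributional_derivative (D : {charge set BR -> \bar R}) :
  distributional_derivative (cumul D) D.
Proof.
pose P := jordan_pos (svalP (hahn_sets D)).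
pose N := jordan_neg (svalP (hahn_sets D)).
split=> [|f tf].
  rewrite charge_cumulE; apply: locally_integrableB.
    exact: (locally_integrable_cumul P).
  exact: (locally_integrable_cumul N).
have key (Q : {finite_measure set BR -> \bar R}) :
    \int[leb]_x (cumul Q x * derive1 f x) = - \int[Q]_x f x.
  have intf := integrable_test_function tf Q.
  rewrite /Rintegral integral_cumul_test_derive// -fineN -integralN//.
  exact: integrable_add_def.
transitivity (- (\int[leb]_x (cumul P x * derive1 f x) -
                 \int[leb]_x (cumul N x * derive1 f x))).
  by rewrite (key P) (key N) opprB opprK addrC.
congr (- _); rewrite -RintegralB//.
- apply: eq_Rintegral => x _; rewrite -mulrBl; congr (_ * _).
  exact/esym/fine_jordan.
- exact: (integrable_cumul_test_derive tf P).
- exact: (integrable_cumul_test_derive tf N).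
Qed.

End charge_distributional_derivative.

(** * Measurability of an infimum over a moving window *)

Section sliding_infimum.
Variable R : realType.
Local Notation BR := (measurableTypeR R).

(* By right continuity, a value below c at some point of [y - l, y + l[ persists
   at a nearby rational, so only the right endpoint must be treated apart. *)
Lemma measurable_sliding_inf (G : R -> R) (l B : R) : 0 <= l ->
  (forall x, G z @[z --> x^'+] --> G x) ->
  measurable_fun setT (G : BR -> R) -> (forall x, B <= G x) ->
  measurable_fun setT
    ((fun y => inf [set G x | x in `[y - l, y + l]%classic]) : BR -> R).
Proof.
move=> l0 Gr mG GB.
pose I (y : R) := [set G x | x in `[y - l, y + l]%classic].
have memI y : I y (G (y + l)).
  by exists (y + l) => //=; rewrite in_itv/= lexx andbT lerD2l ge0_cp.
have infI y : has_inf (I y).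
  by split; [exists (G (y + l))|exists B => _ [x _ <-]].
apply: (measurability _ (RGenInftyO.measurableE R)) => // _ [_ [c ->] <-].
rewrite setTI.
rewrite (_ : _ @^-1` _ = [set y | G (y + l) < c] `|`
    \bigcup_(q in [set q : rat | G (ratr q) < c]) `]ratr q - l, ratr q + l[%classic).
  apply: measurableU.
    have mGl : measurable_fun setT ((fun y => G (y + l)) : BR -> R).
      by apply: measurableT_comp => //; exact: measurable_funD.
    have := mGl measurableT `]-oo, c[%classic (measurable_itv _).
    by rewrite setTI; congr measurable; apply/seteqP; split => y /=;
      rewrite in_itv.
  rewrite bigcup_mkcond; apply: bigcupT_measurable_rat => q.
  by case: ifP => _; [exact: measurable_itv|exact: measurable0].
apply/seteqP; split => y /=.
- rewrite in_itv/= => /(inf_lt (infI y).1)[_ [x + <-] Gx].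
  rewrite /= in_itv/= => /andP[yx]; rewrite le_eqVlt => /predU1P[<-|xy].
    by left.
  right.
  have /nbhs_ballP[e /= e0 eG] : \forall z \near x^'+, G z < c.
    by have /cvgr_lt := Gr x; exact.
  have /rat_in_itvoo[q] : x < Num.min (x + e) (y + l).
    by rewrite lt_min ltrDl e0.
  rewrite in_itv/= lt_min => /andP[xq /andP[qe ql]].
  exists q; last by rewrite /= in_itv/= ltrBlDr ql/= -ltrBlDr (le_lt_trans yx).
  apply: eG => //; rewrite -ball_normE/= ltr_distlC qe andbT.
  by rewrite (lt_trans _ xq)// ltrBlDr ltrDl.
- rewrite in_itv/=; case=> [Gy|[q /= Gq]].
    by apply: le_lt_trans Gy; apply: ge_inf; [exact: (infI y).2|exact: memI].
  rewrite in_itv/= => /andP[q1 q2]; apply: le_lt_trans Gq.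
  apply: ge_inf; first exact: (infI y).2.
  exists (ratr q) => //=; rewrite in_itv/=; apply/andP; split.
    by rewrite lerBlDr ltW.
  by rewrite -lerBlDr ltW.
Qed.

End sliding_infimum.

(** * Integration against a transport plan *)

Section transport_plans.
Variable R : realType.
Local Notation BR := (measurableTypeR R).
Variables (mu nu : probability BR R).
Variable gamma : {measure set (BR * BR) -> \bar R}.
Hypothesis plan : transport_plan mu nu gamma.

Lemma plan_negligible_fst (A : set BR) :
  mu.-negligible A -> gamma.-negligible (fst @^-1` A).
Proof.
move=> [B [mB B0 AB]]; exists (fst @^-1` B); split.
- by rewrite -[X in measurable X]setTI; exact: measurable_fst.
- by rewrite -B0 -(plan.1 B mB).
- by move=> z /AB.
Qed.

Lemma plan_negligible_snd (A : set BR) :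
  nu.-negligible A -> gamma.-negligible (snd @^-1` A).
Proof.
move=> [B [mB B0 AB]]; exists (snd @^-1` B); split.
- by rewrite -[X in measurable X]setTI; exact: measurable_snd.
- by rewrite -B0 -(plan.2 B mB).
- by move=> z /AB.
Qed.

Lemma plan_setT : gamma setT = 1%E.
Proof. by have := plan.1 setT measurableT; rewrite probability_setT. Qed.

(** Change of variables along [phi]; keeping [phi] arbitrary covers both projections at once. *)
Lemma integral_marginal (phi : BR * BR -> BR) (m : {measure set BR -> \bar R})
    (f : BR -> R) :
  measurable_fun setT phi ->
  (forall A, measurable A -> pushforward gamma phi A = m A) ->
  m.-integrable setT (EFin \o f) ->
  gamma.-integrable setT (EFin \o (f \o phi)) /\
  (\int[gamma]_z (f (phi z))%:E = \int[m]_x (f x)%:E)%E.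
Proof.
move=> mphi phim /integrableP[mf foo].
have mE (g : BR -> \bar R) :
    (\int[m]_x g x = \int[pushforward gamma phi]_x g x)%E.
  by apply: eq_measure_integral => A mA _; rewrite -phim.
have intg : gamma.-integrable setT (EFin \o (f \o phi)).
  apply/integrableP; split; first exact: measurableT_comp mf mphi.
  move: foo; rewrite mE ge0_integral_pushforward//.
  exact: measurableT_comp.
by split => //; rewrite mE [RHS]integral_pushforward.
Qed.

Lemma integral_plan (phi psi : R -> R) :
  mu.-integrable setT (EFin \o phi) -> nu.-integrable setT (EFin \o psi) ->
  gamma.-integrable setT (fun z : BR * BR => (phi z.1 + psi z.2)%:E) /\
  (\int[mu]_x phi x + \int[nu]_y psi y =
   \int[gamma]_z (phi z.1 + psi z.2))%R.
Proof.
move=> iphi ipsi.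
have [i1 e1] := integral_marginal measurable_fst plan.1 iphi.
have [i2 e2] := integral_marginal measurable_snd plan.2 ipsi.
split; first exact: (integrableD measurableT i1 i2).
rewrite RintegralD//; congr (fine _ + fine _); exact/esym.
Qed.

Lemma integral_plan_le0 (phi psi : R -> R) :
  mu.-integrable setT (EFin \o phi) -> nu.-integrable setT (EFin \o psi) ->
  gamma.-negligible [set z | ~ (phi z.1 + psi z.2 <= 0)] ->
  \int[mu]_x phi x + \int[nu]_y psi y <= 0.
Proof.
move=> iphi ipsi neg; have [ig ->] := integral_plan iphi ipsi.
have mg := measurable_int _ ig.
(* The integrand agrees almost everywhere with its minimum with 0, whose positive part is
   identically zero. *)
rewrite /Rintegral (@ae_eq_integral _ _ _ _ _
  (fun z : BR * BR => mine (phi z.1 + psi z.2)%:E 0%E))//; last 2 first.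
- exact: measurable_mine.
- apply: negligibleS neg => z /=; apply: contra_not => h _.
  by rewrite min_l.
apply: fine_le0; rewrite integralE [X in (X - _)%E]integral0_eq.
  by rewrite sub0e oppe_le0 integral_ge0.
by move=> z _; rewrite funeposE max_r// ge_min lexx orbT.
Qed.

Lemma integral_plan_eq0 (phi psi : R -> R) :
  mu.-integrable setT (EFin \o phi) -> nu.-integrable setT (EFin \o psi) ->
  gamma.-negligible [set z | phi z.1 + psi z.2 <> 0] ->
  \int[mu]_x phi x + \int[nu]_y psi y = 0.
Proof.
move=> iphi ipsi neg; have [ig ->] := integral_plan iphi ipsi.
have mg := measurable_int _ ig.
rewrite /Rintegral (@ae_eq_integral _ _ _ _ _ (cst 0%E))//.
  by rewrite integral0.
by apply: negligibleS neg => z /=; apply: contra_not => h _; rewrite h.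
Qed.

End transport_plans.

(** * Cost of an optimal plan and the bound on its support *)

Section optimal_plans.
Variable R : realType.
Local Notation BR := (measurableTypeR R).
Variables (mu nu : probability BR R).
Hypothesis cmu : compact (spt (T := R) mu).
Hypothesis cnu : compact (spt (T := R) nu).
Variable gamma : {measure set (BR * BR) -> \bar R}.
Hypothesis opt : optimal_plan mu nu gamma.

(** Optimality makes the cost equal to [Winfty]; since [lambdaC] takes a [fine], finiteness is the
    point. It holds because [gamma] is concentrated on the product of two bounded supports. *)
Lemma sup_cost_lambdaC : sup_cost gamma = (lambdaC mu nu)%:E.
Proof.
have [plan minc] := opt.
have WE : Winfty mu nu = sup_cost gamma.
  apply/eqP; rewrite eq_le; apply/andP; split.
    by apply: ereal_inf_lbound; exists gamma.
  by apply: le_ereal_inf_tmp => _ [g pg <-]; exact: minc.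
rewrite /lambdaC WE fineK//.
(* Positive mass keeps the essential supremum of a nonnegative function from dropping below 0. *)
have gT : (0 < gamma setT)%E by rewrite (plan_setT plan).
rewrite ge0_fin_numE; last first.
  by apply: ess_sup_gee => //; apply: nearW => z; rewrite lee_fin.
have [M [_ bM]] := compact_bounded cmu.
have [N [_ bN]] := compact_bounded cnu.
apply: (@le_lt_trans _ _ (`|M| + 1 + (`|N| + 1))%:E); last exact: ltry.
apply/ess_supP.
have n1 := plan_negligible_fst plan (spt_conull mu).
have n2 := plan_negligible_snd plan (spt_conull nu).
apply: negligibleS (negligibleU n1 n2) => -[x y] /= xy.
apply: contrapT => /not_orP[/= /contrapT sx /contrapT sy]; apply: xy.
rewrite lee_fin (le_trans (ler_normB _ _))// lerD//.
  by apply: (bM (`|M| + 1)) => //; rewrite ltr_pwDr// ler_norm.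
by apply: (bN (`|N| + 1)) => //; rewrite ltr_pwDr// ler_norm.
Qed.

Lemma lambdaC_ge0 : 0 <= lambdaC mu nu.
Proof.
rewrite -lee_fin -sup_cost_lambdaC; apply: ess_sup_gee.
  by rewrite (plan_setT opt.1).
by apply: nearW => z; rewrite lee_fin.
Qed.

(** The set where the cost exceeds [lambdaC] is open and null, so it misses the support: the almost
    everywhere bound holds at every support point. *)
Lemma spt_optimal_dist (z : R * R) : spt (T := (R * R)%type) gamma z ->
  `|z.1 - z.2| <= lambdaC mu nu.
Proof.
move=> sz; rewrite leNgt; apply/negP => lz.
pose U := [set w : R * R | lambdaC mu nu < `|w.1 - w.2|].
have oU : open U.
  rewrite (_ : U = (fun w : R * R => `|w.1 - w.2|) @^-1`
    [set r | lambdaC mu nu < r])//.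
  apply: open_comp => [w _|]; last exact: open_gt.
  by apply: cvg_norm; apply: cvgB; [exact: cvg_fst|exact: cvg_snd].
have := sz U oU lz; suff -> : gamma U = 0%E by rewrite ltxx.
apply: measure_negligible; first exact: open_prod_measurable.
have : (sup_cost gamma <= (lambdaC mu nu)%:E)%E by rewrite sup_cost_lambdaC.
move=> /ess_supP; apply: negligibleS => w /=.
by rewrite lee_fin => Uw; apply/negP; rewrite -ltNge.
Qed.

End optimal_plans.

(** * Atoms are countable, hence invisible to atomless measures *)

Section atoms.
Variable R : realType.
Local Notation BR := (measurableTypeR R).
Local Notation cumul m := (fun x : R => fine (m `]-oo, x]%classic)).

Lemma fine_measure_set1 (P : {finite_measure set BR -> \bar R}) (x : R) :
  fine (P [set x]) = cumul P x - fine (P `]-oo, x[%classic).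
Proof.
apply/eqP; rewrite eq_sym subr_eq addrC -fineD ?fin_num_measure//; apply/eqP.
congr fine; rewrite -measureU//; last first.
  rewrite -subset0 => y /= []; rewrite in_itv/= => /[swap] ->.
  by rewrite ltxx.
congr (P _); apply/seteqP; split => y /=; rewrite !in_itv/= le_eqVlt.
  by move=> /predU1P[->|->]; [right|left].
by case=> [->|->]; rewrite ?eqxx// orbT.
Qed.

(** An atom is a jump of the nondecreasing cumulative function, which has countably many
    discontinuities in each of the windows []-n, n[]. *)
Lemma countable_atoms (P : {finite_measure set BR -> \bar R}) :
  countable [set x : R | P [set x] != 0%E].
Proof.
apply: (@sub_countable _ _ _ (\bigcup_n
    [set x : R | x \in (`](- n%:R), n%:R[) /\ discontinuity (cumul P) x])); last first.
  apply: bigcup_countable => // n _; apply: discontinuity_countable.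
  by move=> x y _ _; exact: cumul_nondecreasing.
apply: subset_card_le => x /= Px.
have l1 := @cumul_cvg_left R P x; have l2 := @cumul_cvg_right R P x.
exists (Num.truncn `|x|).+1 => //=; split.
  by rewrite in_itv/= -ltr_norml truncnS_gt.
split; [by apply/cvg_ex; eexists; exact: l1|by apply/cvg_ex; eexists; exact: l2|].
rewrite (cvg_lim _ l1)// (cvg_lim _ l2)// eq_sym -subr_eq0 -fine_measure_set1.
by rewrite fine_eq0 ?fin_num_measure.
Qed.

Lemma atomless_negligible (m : {measure set BR -> \bar R}) (A : set BR) :
  atomless m -> countable A -> m.-negligible A.
Proof.
move=> m0 /countable_injP[f injf].
pose F (n : nat) : set BR := [set x | A x /\ f x = n].
apply: (@negligibleS _ _ _ _ (\bigcup_n F n)); first by move=> x Ax; exists (f x).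
apply: negligible_bigcup => n.
have [[x [Ax fx]]|Fn0] := pselect (exists x, F n x); last first.
  rewrite (_ : F n = set0); first exact: negligible_set0.
  by rewrite -subset0 => x Fx; apply: Fn0; exists x.
exists [set x]; split => // y [Ay fy] /=.
by apply: injf; rewrite ?inE// fy.
Qed.

End atoms.

(** * Consequences of cyclic monotonicity for the extremal sets *)

Section geometry.
Variable R : realType.
Local Notation BR := (measurableTypeR R).
Variables (gamma : {measure set (BR * BR) -> \bar R}) (l : R).
Hypothesis mono : infty_cyclically_monotone gamma.
Hypothesis dist : forall z : R * R, spt (T := (R * R)%type) gamma z ->
  `|z.1 - z.2| <= l.
Local Notation S := (fun x y : R => spt (T := (R * R)%type) gamma (x, y)).

Lemma two_cycle (x0 y0 x1 y1 : R) : S x0 y0 -> S x1 y1 ->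
  `|x0 - y0| <= Num.max `|x0 - y1| `|x1 - y0|.
Proof.
move=> s0 s1.
pose x (i : 'I_2) := if i == ord0 then x0 else x1.
pose y (i : 'I_2) := if i == ord0 then y0 else y1.
have sxy i : S (x i) (y i) by rewrite /x /y; case: ifP.
have := mono sxy; rewrite !big_ord_recl !big_ord0 /x /y /=.
by rewrite !(max_l (normr_ge0 _)) ge_max => /andP[].
Qed.

(* If z lies in ]y - l, x[ then both crossed costs |z - y| and |x - (z + l)| are
   below l, so exchanging the partners of z and x contradicts monotonicity. *)
Lemma Mplus_gap (z x y : R) : Mplus l gamma z -> S x y ->
  y - l < z -> z < x -> False.
Proof.
move=> sz sxy yz zx.
have := dist sxy; rewrite /= ler_norml => /andP[d1 d2].
have := two_cycle sz sxy; rewrite opprD addrA subrr sub0r normrN.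
rewrite leNgt => /negP; apply; apply: lt_le_trans (ler_norm l).
by rewrite gt_max !ltr_norml; apply/andP; split; apply/andP; split; lra.
Qed.

(** Mirror image of [Mplus_gap]: here the crossed costs are [|z - y|] and [|x - (z - l)|]. *)
Lemma Mminus_gap (z x y : R) : Mminus l gamma z -> S x y ->
  x < z -> z < y + l -> False.
Proof.
move=> sz sxy xz zy.
have := dist sxy; rewrite /= ler_norml => /andP[d1 d2].
have := two_cycle sz sxy; rewrite opprB addrCA subrr addr0.
rewrite leNgt => /negP; apply; apply: lt_le_trans (ler_norm l).
by rewrite gt_max !ltr_norml; apply/andP; split; apply/andP; split; lra.
Qed.

(** The gap lemma at the support point [(x, x - l)] clears []x - 2l, x[] of points of [Mplus], which
    explains the radius [2 * l]. *)
Lemma Mplus_Mminus_left_extreme (x : R) : 0 < l ->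
  Mplus l gamma x -> Mminus l gamma x -> left_extreme (Mplus l gamma) x.
Proof.
move=> l0 xp xm; split => //; exists (2 * l); first by rewrite mulr_gt0.
rewrite -subset0 => z [/=]; rewrite in_itv/= => /andP[xz zx] zp.
apply: (Mplus_gap zp xm) => //.
by move: xz; rewrite mulr_natl mulr2n opprD addrA.
Qed.

End geometry.

(** * Minimality of the cumulative function on the support; support of the positive part *)

Section potentials.
Variable R : realType.
Local Notation BR := (measurableTypeR R).
Local Notation cumul m := (fun x : R => fine (m `]-oo, x]%classic)).

Lemma eq_spt (m1 m2 : set BR -> \bar R) :
  (forall U : set BR, measurable U -> m1 U = m2 U) ->
  spt (T := R) m1 = spt (T := R) m2.
Proof.
move=> m12; apply/seteqP; split => x sx U oU Ux.
  by rewrite -m12; [exact: sx|exact: open_measurable].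
by rewrite m12; [exact: sx|exact: open_measurable].
Qed.

Lemma cumul_eq (P : {finite_measure set BR -> \bar R}) (x x' : R) :
  x <= x' -> P `]x, x']%classic = 0%E -> cumul P x = cumul P x'.
Proof.
move=> xx' P0; congr fine.
rewrite (_ : `]-oo, x']%classic = `]-oo, x]%classic `|` `]x, x']%classic).
  rewrite measureU//; first by rewrite -[LHS]adde0; congr (_ + _)%E.
  rewrite -subset0 => y /= [].
  by rewrite !in_itv/= => yx /andP[]; rewrite ltNge yx.
apply/seteqP; split => y /=; rewrite !in_itv/=.
  by move=> ->; rewrite andbT; have [yx|xy] := leP y x; [left|right].
by case=> [/le_trans/(_ xx')|/andP[]].
Qed.

Lemma charge_diff_cumulE (p m : {finite_measure set BR -> \bar R}) (x : R) :
  cumul (charge_diff p m) x = cumul p x - cumul m x.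
Proof. by rewrite -fineB ?fin_num_measure. Qed.

Variables (gamma : {measure set (BR * BR) -> \bar R}) (l : R).
Hypothesis mono : infty_cyclically_monotone gamma.
Hypothesis dist : forall z : R * R, spt (T := (R * R)%type) gamma z ->
  `|z.1 - z.2| <= l.
Variables p m : {finite_measure set BR -> \bar R}.
Hypothesis sp : spt (T := R) p = Mplus l gamma.
Hypothesis sm : spt (T := R) m = Mminus l gamma.
Local Notation rho := (charge_diff p m).

(* By the gap lemmas [m] does not charge ]x, y + l[ and [p] does not charge
   ]y - l, x[; only atoms at the endpoints y + l and x could spoil minimality. *)
Lemma cumul_min_on_spt (x y x' : R) :
  spt (T := (R * R)%type) gamma (x, y) ->
  p [set x] = 0%E -> m [set y + l] = 0%E ->
  y - l <= x' <= y + l -> cumul rho x <= cumul rho x'.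
Proof.
move=> sxy px my /andP[yx' x'y].
rewrite !charge_diff_cumulE; have [xx'|x'x] := leP x x'.
  rewrite (@cumul_eq m x x')//; first by rewrite lerD2r cumul_nondecreasing.
  have n1 : m.-negligible [set y + l] by apply/negligibleP.
  apply: measure_negligible => //.
  apply: negligibleS (negligibleU (spt_conull m) n1) => z /=.
  rewrite in_itv/= => /andP[xz zx'].
  have := le_trans zx' x'y; rewrite le_eqVlt => /predU1P[->|zy]; [by right|left].
  by rewrite sm => /(Mminus_gap mono dist)/(_ sxy xz zy).
rewrite (@cumul_eq p x' x (ltW x'x)).
  by rewrite lerD2l lerN2 cumul_nondecreasing ?ltW.
have n1 : p.-negligible [set x : BR] by apply/negligibleP.
apply: measure_negligible => //.
apply: negligibleS (negligibleU (spt_conull p) n1) => z /=.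
rewrite in_itv/= => /andP[x'z]; rewrite le_eqVlt => /predU1P[->|zx];
  [by right|left].
by rewrite sp => /(Mplus_gap mono dist)/(_ sxy (le_lt_trans yx' x'z) zx).
Qed.

(** In the singular case the positive part is [p] itself. If [0 < l], domination by [p] gives one
    inclusion, and the jump hypothesis handles the points of the other where [m] could cancel
    [p]. *)
Lemma spt_charge_pos_diff :
  (forall x, Mplus l gamma x ->
    left_extreme (Mplus l gamma) x \/ right_extreme (Mplus l gamma) x ->
    (0 < rho [set x])%E) ->
  0 < l \/ mutually_singular p m ->
  spt (T := R) (charge_pos rho) = Mplus l gamma.
Proof.
move=> jump [l0|sing]; last first.
  by rewrite -sp; apply: eq_spt => U mU; exact: charge_pos_diff_singular.
apply/seteqP; split => [x|x xp U oU Ux].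
  rewrite -sp => sx U oU Ux; apply: lt_le_trans (sx U oU Ux) _.
  by apply: charge_pos_diff_le; exact: open_measurable.
have mU := open_measurable oU.
(* A point of both M+ and M- is left-extreme in M+, hence an atom of the
   positive part; off M-, which is closed, nothing cancels. *)
have [xm|xm] := pselect (Mminus l gamma x).
  have xle := Mplus_Mminus_left_extreme mono dist l0 xp xm.
  have mx : measurable [set x : BR] by exact: measurable_set1.
  apply: lt_le_trans (jump x xp (or_introl xle)) _.
  apply: le_trans (charge_le_pos rho mx) _.
  by rewrite le_measure ?inE// => y ->.
move: xm; rewrite -sm => /existsNP[V /not_implyP[oV] /not_implyP[Vx]].
move=> /negP; rewrite -leNgt => mV.
have oUV : open (U `&` V) by exact: openI.
have mUV := open_measurable oUV.
have UV0 : m (U `&` V) = 0%E.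
  apply/eqP; rewrite eq_le measure_ge0 andbT; apply: le_trans mV.
  by rewrite le_measure ?inE//; exact: open_measurable.
apply: (@lt_le_trans _ _ (charge_pos rho (U `&` V))); last first.
  by rewrite le_measure ?inE//; exact: subIsetl.
rewrite charge_pos_diff_disjoint//.
by move: xp; rewrite -sp; apply.
Qed.

End potentials.

(** * Admissibility and optimality of the potentials *)

Section kantorovich.
Variable R : realType.
Local Notation BR := (measurableTypeR R).
Local Notation cumul m := (fun x : R => fine (m `]-oo, x]%classic)).

(** Converts the positive atoms of hypothesis (b) into strict jumps of [phi_r]. *)
Lemma fine_charge_set1 (D : {charge set BR -> \bar R}) (x : R) :
  fine (D [set x]) = cumul D x - fine (D `]-oo, x[%classic).
Proof.
have mx : measurable [set x : BR] by exact: measurable_set1.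
have e1 : fine (charge_pos D [set x]) =
    cumul (charge_pos D) x - fine (charge_pos D `]-oo, x[%classic).
  exact: (fine_measure_set1 (jordan_pos (svalP (hahn_sets D)))).
have e2 : fine (charge_neg D [set x]) =
    cumul (charge_neg D) x - fine (charge_neg D `]-oo, x[%classic).
  exact: (fine_measure_set1 (jordan_neg (svalP (hahn_sets D)))).
rewrite !(fine_jordan D)// e1 e2 !opprB.
by rewrite addrACA [in RHS]addrACA; congr (_ + _); rewrite addrC.
Qed.

Variables (mu nu : probability BR R).
Variable rho : {charge set BR -> \bar R}.
Variable l : R.
Hypothesis l0 : 0 <= l.

Lemma bounded_charge_cumul : exists B, forall x, `|cumul rho x| <= B.
Proof.
exists (fine (charge_pos rho setT) + fine (charge_neg rho setT)) => x.
have /andP[p0 p1] := cumul_ge0_le (jordan_pos (svalP (hahn_sets rho))) x.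
have /andP[n0 n1] := cumul_ge0_le (jordan_neg (svalP (hahn_sets rho))) x.
rewrite fine_jordan//; apply: le_trans (ler_normB _ _) _.
by apply: lerD; rewrite ger0_norm.
Qed.

Lemma measurable_charge_cumul : measurable_fun setT (cumul rho : BR -> R).
Proof.
rewrite charge_cumulE; apply: measurable_funB.
  exact: (measurable_cumul (jordan_pos (svalP (hahn_sets rho)))).
exact: (measurable_cumul (jordan_neg (svalP (hahn_sets rho)))).
Qed.

Lemma psi_rE (y : R) :
  psi_r l rho y = inf [set cumul rho x | x in `[y - l, y + l]%classic].
Proof.
congr inf; apply/seteqP; split => z [x xy <-]; exists x => //=;
  by rewrite /phi_r opprK.
Qed.

Lemma has_lbound_psi_r (y : R) :
  has_lbound [set cumul rho x | x in `[y - l, y + l]%classic].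
Proof.
have [B BG] := bounded_charge_cumul.
by exists (- B) => _ [x _ <-]; have := BG x; rewrite ler_norml => /andP[].
Qed.

Lemma psi_r_le (x y : R) : `|y - x| <= l -> psi_r l rho y <= cumul rho x.
Proof.
move=> xy; rewrite psi_rE; apply: ge_inf; first exact: has_lbound_psi_r.
exists x => //=; rewrite in_itv/=.
by move: xy; rewrite distrC ler_distl.
Qed.

Lemma le_psi_r (c y : R) :
  (forall x, y - l <= x <= y + l -> c <= cumul rho x) -> c <= psi_r l rho y.
Proof.
move=> cG; rewrite psi_rE; apply: lb_le_inf.
  (* Since [0 <= l] the window contains [y], so [inf] is not taken over the empty set, where it has
     a default value. *)
  exists (cumul rho y), y => //=; rewrite in_itv/=.
  by rewrite lerBlDr lerDl l0.
by move=> _ [x /= xy <-]; apply: cG; move: xy; rewrite in_itv.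
Qed.

(** Both functions are bounded and measurable, and [mu], [nu] are finite. The constraint holds at
    every pair, [psi_r] being an infimum, so both exceptional sets are empty. *)
Lemma admissible_potentials :
  admissible mu nu l (phi_r rho) (psi_r l rho).
Proof.
have [B BG] := bounded_charge_cumul.
split.
- apply: measurable_bounded_integrable => //.
  + by rewrite -ge0_fin_numE// fin_num_measure.
  + by apply: measurable_funN; exact: measurable_charge_cumul.
  + exists B; split; first exact: num_real.
    by move=> M BM x _ /=; rewrite /phi_r normrN (le_trans (BG x))// ltW.
- apply: measurable_bounded_integrable => //.
  + by rewrite -ge0_fin_numE// fin_num_measure.
  + rewrite (funext psi_rE); apply: (@measurable_sliding_inf _ _ _ (- B)) => //.
    * by move=> x; exact: charge_cumul_cvg_right.
    * exact: measurable_charge_cumul.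
    * by move=> x; have := BG x; rewrite ler_norml => /andP[].
  + exists B; split; first exact: num_real.
    move=> M BM y _ /=; apply: le_trans (ltW BM); rewrite ler_norml.
    apply/andP; split.
      by apply: le_psi_r => x _; have := BG x; rewrite ler_norml => /andP[].
    apply: (@le_trans _ _ (cumul rho y)); last first.
      by have := BG y; rewrite ler_norml => /andP[].
    by apply: psi_r_le; rewrite subrr normr0.
- exists set0, set0; split; [exact: negligible_set0|exact: negligible_set0|].
  by move=> x y _ _ /psi_r_le xy; rewrite /phi_r addrC subr_le0.
Qed.

Variable gamma : {measure set (BR * BR) -> \bar R}.
Hypothesis plan : transport_plan mu nu gamma.
Hypothesis cost : (sup_cost gamma <= l%:E)%E.

(** Weak duality: both exceptional sets pull back to [gamma]-null sets, and [gamma]-almost every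
    pair is within distance [l], so the constraint can be integrated along [gamma]. *)
Lemma admissible_integral_le0 (phi psi : R -> R) :
  admissible mu nu l phi psi -> \int[mu]_x phi x + \int[nu]_y psi y <= 0.
Proof.
move=> [iphi ipsi [N1 [N2 [n1 n2 adm]]]].
apply: (integral_plan_le0 plan) => //.
move/ess_supP : cost => neg.
apply: negligibleS (negligibleU neg (negligibleU
  (plan_negligible_fst plan n1) (plan_negligible_snd plan n2))) => z /= zgt.
apply: contrapT => /not_orP[/contrapT zl /not_orP[z1 z2]]; apply: zgt.
by apply: adm => //; rewrite distrC -lee_fin.
Qed.

(** Off the negligible set the window around [z.2] has its minimum at [z.1], so the two potentials
    sum to 0 there and the value 0 allowed by weak duality is attained. *)
Lemma kantorovich_pair_potentials :
  gamma.-negligible [set z | exists2 x, z.2 - l <= x <= z.2 + l &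
    cumul rho x < cumul rho z.1] ->
  kantorovich_pair mu nu l (phi_r rho) (psi_r l rho).
Proof.
move=> neg; have adm := admissible_potentials; split => // phi' psi' adm'.
rewrite [leRHS](@integral_plan_eq0 _ _ _ _ plan).
- exact: admissible_integral_le0.
- by case: adm.
- by case: adm.
move/ess_supP : cost => negc; apply: negligibleS (negligibleU negc neg) => z /=.
move=> zneq; apply: contrapT => /not_orP[/contrapT zl nz]; apply: zneq.
apply/eqP; rewrite /phi_r addrC subr_eq0 eq_le; apply/andP; split.
  by apply: psi_r_le; rewrite distrC -lee_fin.
apply: le_psi_r => x xz; rewrite leNgt; apply/negP => xlt.
by apply: nz; exists x.
Qed.

End kantorovich.

(** * Regularity of [phi_r], supports, jumps and optimality, assembled *)

Theorem theorem3p6 (R : realType)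
  (mu nu : probability (measurableTypeR R) R)
  (hmu_cpt : compact (spt (T := R) mu)) (hnu_cpt : compact (spt (T := R) nu))
  (hmu_atom : atomless mu) (hnu_atom : atomless nu)
  (gamma : {measure set (measurableTypeR R * measurableTypeR R) -> \bar R})
  (hgamma_opt : optimal_plan mu nu gamma)
  (hgamma_mon : infty_cyclically_monotone gamma)
  (rhop rhom : {finite_measure set (measurableTypeR R) -> \bar R})
  (l := lambdaC mu nu)
  (Mp := Mplus l gamma) (Mm := Mminus l gamma) (M := Mp `|` Mm)
  (rho := charge_diff rhop rhom)
  (ha_p : spt (T := R) rhop = Mp)
  (ha_m : spt (T := R) rhom = Mm)
  (ha : spt (T := R) (charge_tv rho) = M)
  (hb : forall x : R, Mp x -> left_extreme Mp x \/ right_extreme Mp x ->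
          (0 < rho [set x])%E)
  (phi := phi_r rho) (psi := psi_r l rho) :
  (* (i) *)
  [/\ [/\ bounded_variation_line phi,
          forall x : R, cvg (phi z @[z --> x^'-]),
          forall x : R, cvg (phi z @[z --> x^'+]) &
          right_continuous phi],
  (* (ii) *)
      exists D : {charge set (measurableTypeR R) -> \bar R},
        [/\ distributional_derivative phi D,
            (* false if lambda_C = 0 and rhop, rhom overlap, e.g. mu = nu uniform on
               [0, 1], rhop = Leb + delta_0 + delta_1, rhom = 2 Leb on [0, 1] *)
            (0 < l \/ mutually_singular rhop rhom ->
              spt (T := R) (charge_neg D) = Mp) &
            spt (T := R) (charge_tv D) = M],
  (* (iii) *)
      forall x : R, Mp x -> left_extreme Mp x \/ right_extreme Mp x ->
        phi x < lim (phi z @[z --> x^'-]) &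
  (* (iv) *)
      kantorovich_pair mu nu l phi psi].
Proof.
have dist := spt_optimal_dist hmu_cpt hnu_cpt hgamma_opt.
have costE := sup_cost_lambdaC hmu_cpt hnu_cpt hgamma_opt.
have plan := hgamma_opt.1.
have phiE : phi = fun x => fine (copp rho `]-oo, x]%classic) by exact: phi_rE.
have phil x : phi z @[z --> x^'-] --> fine (copp rho `]-oo, x[%classic).
  by rewrite phiE; exact: charge_cumul_cvg_left.
have phir x : phi z @[z --> x^'+] --> phi x.
  by rewrite phiE; exact: charge_cumul_cvg_right.
split.
- split => [|x|x|//].
  + by rewrite phiE; exact: charge_cumul_bounded_variation.
  + by apply/cvg_ex; eexists; exact: phil.
  + by apply/cvg_ex; eexists; exact: phir.
(* The derivative is [- rho], so its negative part is the positive part of [rho]. *)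
- exists (copp rho); split => [|sing|].
  + by rewrite phiE; exact: cumul_distributional_derivative.
  + transitivity (spt (T := R) (charge_pos rho)).
      by apply: eq_spt => U mU; exact: charge_neg_copp.
    exact: (spt_charge_pos_diff hgamma_mon dist ha_p ha_m hb sing).
  + by rewrite -ha; apply: eq_spt => U mU; exact: charge_tv_copp.
- move=> x xp xe; rewrite (cvg_lim _ (phil x))// phiE -subr_lt0.
  rewrite -fine_charge_set1 /copp/= fineN oppr_lt0; apply: fine_gt0.
  rewrite hb//=.
  have : rho [set x] \is a fin_num by apply: fin_num_measure; exact: measurable_set1.
  by rewrite fin_numElt => /andP[].
- apply: (kantorovich_pair_potentials _ plan).
  + exact: lambdaC_ge0 hgamma_opt.
  + by rewrite costE.
  (* Exceptional pairs have [x] among the atoms of [rhop] or [y + l] among those of [rhom]: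
     countably many values of each coordinate, null for [mu] and [nu]. *)
  have n1 := plan_negligible_fst plan
    (atomless_negligible hmu_atom (countable_atoms rhop)).
  have cm : countable [set y : R | rhom [set y + l] != 0%E].
    apply: sub_countable (countable_atoms rhom).
    apply: card_le_trans (card_image_le (fun z => z - l) _).
    by apply: subset_card_le => y /= my; exists (y + l); rewrite ?addrK.
  have n2 := plan_negligible_snd plan (atomless_negligible hnu_atom cm).
  apply: negligibleS (negligibleU (spt_prod_conull gamma) (negligibleU n1 n2)).
  move=> [x y] /= [x' x'y]; apply: contraPP => /not_orP[/contrapT sxy].
  move=> /not_orP[/= /negP/negPn/eqP px /negP/negPn/eqP my].
  apply/negP; rewrite -leNgt.
  exact: (cumul_min_on_spt hgamma_mon dist ha_p ha_m sxy px my x'y).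
Qed.
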